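(* Let $T_t$ be the special flow over the dyadic odometer on $M=[0,1)^2$. Let $(p_n)$ be natural numbers with $p_{n+1}\ge p_n+2$, let $d_n\in(0,1/2)$, $a_n>0$, and assume $$\sum_{m=n+1}^\infty a_m=o(a_nd_n)\quad (n\to\infty),\qquad 2^{p_n-2}<d_m2^{p_m-1}\ \text{ for all } m>n .$$ Put $L_n=d_n2^{p_n-1}$ and define $f_n:[0,2^{-p_n})\times[0,2^{p_n})\to\mathbb{R}$ by $f_n(u,v)=a_n$ if $0\le v<L_n$, $f_n(u,v)=-a_n$ if $2^{p_n-1}\le v<2^{p_n-1}+L_n$, and $f_n(u,v)=0$ otherwise. Let $f(x,y)=\sum_{n=1}^\infty f_n(\Phi_{p_n}^{-1}(x,y))$ and $t_n=2^{p_n-2}$. Then $f\in L_1(M)$ has zero mean and $$\sup_{(x,y)\in M}|A(f,t_n,(x,y))|=\mathcal{O}(a_nd_n)\quad (n\to\infty).$$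
   Context: Dyadic odometer: $S:[0,1)\to[0,1)$ defined on $x=\sum_{i\ge1}x_i2^{-i}$ (binary expansion, not eventually all $1$) by: if $x_1=\dots=x_m=1$ and $x_{m+1}=0$ ($m\ge0$), then $S$ replaces these first $m+1$ digits by $0,\dots,0,1$, other digits unchanged. The special flow over $S$ with constant return time $1$ is the flow on $M=[0,1)^2$ given by $T_t(x,y)=(S^{\lfloor y+t\rfloor}x,\ y+t-\lfloor y+t\rfloor)$, $t\ge0$, preserving Lebesgue measure $m$. For $p\in\mathbb{N}$, $\Phi_p:[0,2^{-p})\times[0,2^p)\to M$, $\Phi_p(u,v)=T_v(u,0)$, is a measure-preserving bijection (mod 0). Birkhoff average: $A(f,t,z)=\frac1t\int_0^t f(T_sz)\,ds$. *)

(* Defs.v *)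
From HB Require Import structures.
From mathcomp Require Import all_boot all_order all_algebra.
From mathcomp Require Import all_classical all_reals all_analysis.
Set Implicit Arguments. Unset Strict Implicit. Unset Printing Implicit Defensive.
Import Order.TTheory GRing.Theory Num.Theory.
Import numFieldNormedType.Exports.
Local Open Scope classical_set_scope.
Local Open Scope ring_scope.

Section Odometer.
Variable R : realType.

Definition Msq : set (R * R) := [set z | (0 <= z.1 < 1) /\ (0 <= z.2 < 1)].

(* i-th binary digit (i >= 1) of x in [0,1): the greedy expansion, which is the
   expansion that is not eventually all 1 *)
Definition bdigit (i : nat) (x : R) : int := ((Num.floor (x * 2 ^+ i)) %% 2)%Z.

Definition lead_ones (x : R) : nat :=
  xget 0%N [set m : nat | (forall i : nat, (1 <= i <= m)%N -> bdigit i x = 1)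
                          /\ bdigit m.+1 x = 0].

(* the dyadic odometer: replace the first m+1 digits 1,...,1,0 by 0,...,0,1 *)
Definition odometer (x : R) : R :=
  let m := lead_ones x in
  x - (\sum_(i < m) (2 ^+ i.+1)^-1) + (2 ^+ m.+1)^-1.

(* the special flow over the odometer with constant roof 1 *)
Definition flow (t : R) (z : R * R) : R * R :=
  (iter `|Num.floor (z.2 + t)|%N odometer z.1,
   z.2 + t - (Num.floor (z.2 + t))%:~R).

Definition Phi_dom (p : nat) : set (R * R) :=
  [set w | (0 <= w.1 < (2 ^+ p)^-1) /\ (0 <= w.2 < 2 ^+ p)].

Definition Phi (p : nat) (w : R * R) : R * R := flow w.2 (w.1, 0).

(* inverse of the bijection Phi_p : Phi_dom p -> Msq *)
Definition Phi_inv (p : nat) (z : R * R) : R * R :=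
  xget (0, 0) [set w | Phi_dom p w /\ Phi p w = z].

Definition birkhoff (f : R * R -> R) (t : R) (z : R * R) : R :=
  t^-1 * \int[lebesgue_measure]_(s in `[0, t]) f (flow s z).

Definition Lseq (p : nat -> nat) (d : nat -> R) (n : nat) : R :=
  d n * 2 ^ ((p n)%:Z - 1).

Definition fpiece (p : nat -> nat) (d a : nat -> R) (n : nat) (w : R * R) : R :=
  if (0 <= w.2) && (w.2 < Lseq p d n) then a n
  else if (2 ^ ((p n)%:Z - 1) <= w.2) && (w.2 < 2 ^ ((p n)%:Z - 1) + Lseq p d n)
  then - a n else 0.

Definition fsum (p : nat -> nat) (d a : nat -> R) (z : R * R) : R :=
  limn (fun N => \sum_(n < N) fpiece p d a n (Phi_inv (p n) z)).

End Odometer.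

(* Main.v *)
Require Import Defs.
From HB Require Import structures.
From mathcomp Require Import all_boot all_order all_algebra.
From mathcomp Require Import all_classical all_reals all_analysis.
From mathcomp Require Import measurable_realfun ring lra zify.
Import Order.TTheory GRing.Theory Num.Theory.
Import numFieldNormedType.Exports.
Local Open Scope classical_set_scope.
Local Open Scope ring_scope.

(* Read the first [p] binary digits of [x] as an integer [revcode p x], least
   significant digit first.  The odometer increments this integer modulo
   [2 ^ p], so in the coordinates of [Phi p] the flow is the translation
   [v -> v + s] modulo [2 ^ p], with [v = revcode p x + y], and along an orbit
   the [n]-th summand of [f] becomes a periodic step function that changes sign
   under translation by half of its period [2 ^ p n].  In the Birkhoff integral
   up to [t_n = 2 ^ (p n - 2)], each summand [m < n] runs through whole periods
   and contributes [0]; the summand [n] is nonzero on a set of measure at most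
   [2 * Lseq p d n], which contributes [4 * (a n * d n)] to the average; the
   summands [m > n] contribute at most the tail of the series of [a], that is
   [o(a n * d n)].  The mean of each summand vanishes because flipping the last
   digit read (or, for [p n = 0], shifting [y] by [1/2]) changes its sign. *)

(** * Binary digits, carries and the coding of the odometer *)

Section odometer_coding.
Context {R : realType}.
Implicit Types (x u s : R) (p m n k : nat) (z w : R * R).

(** The doubling map modulo 1 on [[0, 1)]: it drops the first binary digit, and the subtracted
    boolean is that digit. *)
Definition dbl x : R := 2 * x - (2^-1 <= x)%R%:R.

Fixpoint revcode p x : nat :=
  if p is q.+1 then ((2^-1 <= x)%R + (revcode q (dbl x)).*2)%N else 0%N.

Lemma dbl_itv x : 0 <= x < 1 -> 0 <= dbl x < 1.
Proof. by rewrite /dbl; case: (lerP 2^-1 x) => /= ? /andP[? ?]; lra. Qed.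

Lemma iter_dbl_itv p x : 0 <= x < 1 -> 0 <= iter p dbl x < 1.
Proof. by move=> x01; elim: p => //= p; exact: dbl_itv. Qed.

Lemma bdigit1 x : 0 <= x < 1 -> bdigit 1 x = (2^-1 <= x)%R%:R.
Proof.
move=> x01; rewrite /bdigit expr1; case: (lerP 2^-1 x) => h.
  by rewrite (@floor_def _ _ 1)//; lra.
by rewrite (@floor_def _ _ 0)//; lra.
Qed.

Lemma bdigitS i x : 0 <= x < 1 -> bdigit i.+2 x = bdigit i.+1 (dbl x).
Proof.
move=> x01; rewrite /bdigit.
(* The two scaled numbers differ by [0] or by the even integer [2 ^+ i.+1], so the floors agree
   modulo 2. *)
have -> : dbl x * 2 ^+ i.+1 = x * 2 ^+ i.+2 + (- ((2^-1 <= x)%R%:R * 2 ^+ i.+1))%:~R.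
  by rewrite /dbl rmorphN rmorphM rmorphXn /= rmorph_nat (exprS _ i.+1); ring.
rewrite floorDrz ?intr_int// intrKfloor; case: (_ <= _).
  by rewrite mul1r (exprSr (2 : int)) -mulNr addrC modzMDl.
by rewrite mul0r oppr0 addr0.
Qed.

Let is_lead_ones x m := (forall i : nat, (1 <= i <= m)%N -> bdigit i x = 1)
  /\ bdigit m.+1 x = 0.

Let is_lead_ones_uniq x m n : is_lead_ones x m -> is_lead_ones x n -> m = n.
Proof.
move=> [m1 m0] [n1 n0]; case: (ltngtP m n) => // mn.
- by move: m0; rewrite n1.
- by move: n0; rewrite m1.
Qed.

Let is_lead_onesS x m : 2^-1 <= x < 1 -> is_lead_ones (dbl x) m ->
  is_lead_ones x m.+1.
Proof.
move=> x01 [m1 m0]; have x01' : 0 <= x < 1 by lra.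
have x2 : (2^-1 <= x)%R by lra.
split=> [[//|[_|i /andP[_ im]]]|].
- by rewrite bdigit1// x2.
- by rewrite bdigitS// m1.
- by rewrite bdigitS.
Qed.

Let is_lead_ones0 x : 0 <= x < 2^-1 -> is_lead_ones x 0.
Proof.
move=> x01; split=> [i|]; first by lia.
by rewrite bdigit1; [rewrite leNgt (_ : x < 2^-1)//|]; lra.
Qed.

(** Doubling on [[1/2, 1)] doubles the distance to 1, since [1 - dbl x = 2 * (1 - x)]; hence
    finitely many doublings lead below [1/2]. This expresses that the digits are not all 1, and it
    drives every recursion along a run of leading ones. *)
Let below_one_ind (P : R -> Prop) :
  (forall x, 0 <= x < 2^-1 -> P x) ->
  (forall x, 2^-1 <= x < 1 -> P (dbl x) -> P x) ->
  forall x, 0 <= x < 1 -> P x.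
Proof.
move=> P0 P1 x /andP[x0 x1].
have [n hn] : exists n, x < 1 - 2^-1 ^+ n.
  have e0 : 0 < 1 - x by rewrite subr_gt0.
  have [N _ /(_ N (leqnn N))] := near_infty_natSinv_expn_lt (PosNum e0).
  by move=> /= hN; exists N; rewrite exprVn -div1r; lra.
elim: n x x0 {x1} hn => [|n IH] x x0 hn.
  by move: hn; rewrite expr0; lra.
have [x2|x2] := ltP x 2^-1; first by apply: P0; rewrite x0.
have n0 : (0 : R) < 2^-1 ^+ n by rewrite exprn_gt0.
rewrite exprS in hn.
apply: P1; first by lra.
by apply: IH; rewrite /dbl x2 /=; lra.
Qed.

(** [lead_ones] is defined by [xget] with default [0], so it is meaningful only once some admissible
    [m] is exhibited. *)
Let lead_onesP x : 0 <= x < 1 -> is_lead_ones x (lead_ones x).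
Proof.
move=> x01; apply: xgetPex.
elim/below_one_ind: x / x01 => [x x2|x x2 [m hm]].
  by exists 0%N; exact: is_lead_ones0.
by exists m.+1; exact: is_lead_onesS.
Qed.

Lemma odometer_lt_half x : 0 <= x < 2^-1 -> odometer x = x + 2^-1.
Proof.
move=> x2; rewrite /odometer (_ : lead_ones x = 0%N).
  by rewrite big_ord0 subr0 expr1.
by apply: (@is_lead_ones_uniq x); [apply: lead_onesP; lra|exact: is_lead_ones0].
Qed.

(** Self-similarity of the odometer: a leading 1 turns into 0 and the carry acts on the remaining
    digits. *)
Lemma odometer_ge_half x : 2^-1 <= x < 1 -> odometer x = odometer (dbl x) / 2.
Proof.
move=> x2; have x01 : 0 <= x < 1 by lra.
rewrite /odometer (_ : lead_ones x = (lead_ones (dbl x)).+1).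
  set m := lead_ones _; rewrite /dbl (_ : (2^-1 <= x)%R); last by lra.
  rewrite big_ord_recl /= (exprS _ m.+1) expr1 invfM.
  under eq_bigr => i _ do rewrite /bump /= exprS invfM.
  by rewrite -mulr_sumr; field.
apply: (@is_lead_ones_uniq x); first exact: lead_onesP.
by apply: is_lead_onesS => //; exact/lead_onesP/dbl_itv.
Qed.

Lemma odometer_itv x : 0 <= x < 1 -> 0 <= odometer x < 1.
Proof.
elim/below_one_ind: x / => [x x2|x x2 IH].
  by rewrite odometer_lt_half//; lra.
by rewrite odometer_ge_half//; lra.
Qed.

Lemma iter_odometer_itv k x : 0 <= x < 1 -> 0 <= iter k (@odometer R) x < 1.
Proof. by move=> x01; elim: k => //= k; exact: odometer_itv. Qed.

Lemma dbl_odometer_lt_half x : 0 <= x < 2^-1 -> dbl (odometer x) = dbl x.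
Proof.
move=> x2; rewrite odometer_lt_half// /dbl (_ : (2^-1 <= x) = false).
  by rewrite (_ : (2^-1 <= x + 2^-1)%R); [rewrite /=; field|lra].
by apply/negbTE; rewrite -ltNge; lra.
Qed.

Lemma dbl_odometer_ge_half x : 2^-1 <= x < 1 ->
  dbl (odometer x) = odometer (dbl x).
Proof.
move=> x2; rewrite odometer_ge_half// {1}/dbl.
have /odometer_itv : 0 <= dbl x < 1 by apply: dbl_itv; lra.
set y := odometer _ => y01; rewrite (_ : (2^-1 <= y / 2) = false).
  by rewrite subr0; field.
by apply/negbTE; rewrite -ltNge; lra.
Qed.

Lemma revcode_lt p x : (revcode p x < 2 ^ p)%N.
Proof.
elim: p x => //= p IH x; have := IH (dbl x); rewrite expnS; case: (_ <= _)%R; lia.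
Qed.

(** Addition of one with carry: a first digit 0 becomes 1 and absorbs the carry, a first digit 1
    becomes 0 and hands the carry to [dbl x]. The remainder modulo [2 ^ p] accounts for a carry
    leaving the first [p] digits. *)
Lemma revcode_odometer p x : 0 <= x < 1 ->
  revcode p (odometer x) = ((revcode p x).+1 %% 2 ^ p)%N.
Proof.
elim: p x => [|p IH] x x01 /=; first by rewrite modn1.
have [x2|x2] := ltP x 2^-1.
  rewrite dbl_odometer_lt_half; last by lra.
  rewrite odometer_lt_half; last by lra.
  rewrite (_ : (2^-1 <= x + 2^-1)%R); last by lra.
  by have h := revcode_lt p (dbl x); rewrite expnS modn_small; lia.
rewrite dbl_odometer_ge_half; last by lra.
rewrite odometer_ge_half; last by lra.
have x01' := dbl_itv _ x01; have y01 := odometer_itv _ x01'.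
rewrite (_ : (2^-1 <= _ / 2) = false); last by apply/negbTE; rewrite -ltNge; lra.
by rewrite IH// expnS -!mul2n muln_modr; congr modn; lia.
Qed.

Lemma revcode_iter_odometer p k x : 0 <= x < 1 ->
  revcode p (iter k (@odometer R) x) = ((revcode p x + k) %% 2 ^ p)%N.
Proof.
move=> x01; elim: k => [|k IH] /=.
  by rewrite addn0 modn_small// revcode_lt.
rewrite revcode_odometer ?iter_odometer_itv// IH -addn1 modnDml.
by congr modn; lia.
Qed.

(** Without overflow of the code the carry is absorbed among the first [p] digits, so the later
    digits stay as they are. *)
Lemma iter_dbl_odometer p x : 0 <= x < 1 -> ((revcode p x).+1 < 2 ^ p)%N ->
  iter p dbl (odometer x) = iter p dbl x.
Proof.
elim: p x => [|p IH] x x01; first by [].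
rewrite !iterSr /=; have [x2|x2] := ltP x 2^-1 => h.
  by rewrite dbl_odometer_lt_half//; lra.
rewrite dbl_odometer_ge_half; last by lra.
by rewrite IH ?dbl_itv//; move: h; rewrite expnS; lia.
Qed.

Lemma iter_dbl_iter_odometer p k x : 0 <= x < 1 ->
  (revcode p x + k < 2 ^ p)%N -> iter p dbl (iter k (@odometer R) x) = iter p dbl x.
Proof.
move=> x01; elim: k => //= k IH h.
rewrite iter_dbl_odometer ?iter_odometer_itv ?IH//; first by lia.
by rewrite revcode_iter_odometer// modn_small; lia.
Qed.

Lemma revcode_iter_dbl_inj p x u : 0 <= x < 1 -> 0 <= u < 1 ->
  revcode p x = revcode p u -> iter p dbl x = iter p dbl u -> x = u.
Proof.
elim: p x u => [|p IH] x u x01 u01; first by [].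
rewrite !iterSr /= => hK hD.
have xu : (2^-1 <= x) = (2^-1 <= u).
  by move: hK; case: (_ <= x); case: (_ <= u) => //; lia.
have : dbl x = dbl u.
  by apply: IH => //; rewrite ?dbl_itv//; move: hK; rewrite xu; lia.
by rewrite /dbl xu; lra.
Qed.

Lemma revcode_small p u : 0 <= u < (2 ^+ p)^-1 ->
  revcode p u = 0%N /\ iter p dbl u = 2 ^+ p * u.
Proof.
elim: p u => [|p IH] u; first by rewrite expr0 mul1r.
rewrite iterSr /= exprS invfM => u01.
have p1 : (2 ^+ p : R)^-1 <= 1 by rewrite invf_le1 ?exprn_gt0// exprn_ege1// ler1n.
have u2 : dbl u = 2 * u.
  by rewrite /dbl (_ : (2^-1 <= u) = false) ?subr0//; apply/negbTE; rewrite -ltNge; lra.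
have [|-> ->] := IH (dbl u); first by rewrite u2; lra.
rewrite u2 (_ : (2^-1 <= u) = false); last by apply/negbTE; rewrite -ltNge; lra.
by split => //; ring.
Qed.

(** For [x] in [[0, 1)] this identifies [iter q dbl x] as the fractional part of [2 ^+ q * x]. *)
Lemma iter_dbl_frac q x : exists k : int, 2 ^+ q * x = k%:~R + iter q dbl x.
Proof.
elim: q => [|q [k IH]] /=; first by exists 0; rewrite expr0 mul1r add0r.
exists (2 * k + (2^-1 <= iter q dbl x)%R%:R).
rewrite exprS -mulrA IH rmorphD rmorphM /= !rmorph_nat /dbl.
by ring.
Qed.

(* The second hypothesis says that the [q.+1]-st binary digit of [x] is [0]. *)
Lemma revcode_toggle q x : 0 <= x < 1 -> iter q dbl x < 2^-1 ->
  x + (2 ^+ q.+1)^-1 < 1 /\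
  revcode q.+1 (x + (2 ^+ q.+1)^-1) = (revcode q.+1 x + 2 ^ q)%N.
Proof.
elim: q x => [|q IH] x x01.
  rewrite /= expr1 => x2; split; first by lra.
  rewrite (_ : (2^-1 <= x + 2^-1)%R); last by lra.
  by rewrite leNgt x2.
rewrite iterSr => /(IH _ (dbl_itv _ x01)) [].
set e := (2 ^+ q.+1)^-1; have -> : (2 ^+ q.+2)^-1 = e / 2 :> R.
  by rewrite exprSr invfM.
have e0 : 0 < e by rewrite invr_gt0 exprn_gt0.
move=> h1 h2.
(* The first digit survives the addition: crossing [1/2] would force [dbl x + e] to reach 1, against
   [h1]. *)
have hx : (2^-1 <= x + e / 2) = (2^-1 <= x).
  apply/idP/idP => hh; last by lra.
  by rewrite leNgt; apply/negP => x2; move: h1; rewrite /dbl leNgt x2 /=; lra.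
have hd : dbl (x + e / 2) = dbl x + e by rewrite /dbl hx; field.
split; first by move: h1; rewrite /dbl; case: (lerP 2^-1 x) => /=; lra.
by rewrite [LHS]/= [X in (X + _)%N]/= hx hd; move: h2; rewrite /= expnS; lia.
Qed.

(** * Real remainders and the phase of a point in the coordinates of [Phi p] *)

Definition rmod (P r : R) : R := r - P * (Num.floor (r / P))%:~R.

Lemma rmod_itv P r : 0 < P -> 0 <= rmod P r < P.
Proof.
move=> P0; rewrite /rmod; set k := Num.floor _.
have := floor_itv (r / P); rewrite -/k ler_pdivlMr// ltr_pdivrMr// intrD; lra.
Qed.

Lemma rmodE P (k : int) c : 0 < P -> 0 <= c < P -> rmod P (P * k%:~R + c) = c.
Proof.
move=> P0 c01; rewrite /rmod (@floor_def _ _ k); first by ring.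
by rewrite ler_pdivlMr// ltr_pdivrMr// intrD; lra.
Qed.

Lemma Phi_inv_phase p z : @Msq R z ->
  (Phi_inv p z).2 = (revcode p z.1)%:R + z.2.
Proof.
case: z => x y [/= x01 y01].
have P0 : 0 < (2 ^+ p : R) by rewrite exprn_gt0.
have : [set w | @Phi_dom R p w /\ Phi p w = (x, y)] (Phi_inv p (x, y)).
  (* The preimage puts [p] zeros in front of the digits of [x] after the [p]-th. From this point of
     code [0], [revcode p x] steps of the odometer rebuild the first [p] digits of [x] without
     overflow. *)
  apply: xgetPex; exists (iter p dbl x / 2 ^+ p, (revcode p x)%:R + y).
  have t01 := iter_dbl_itv p _ x01.
  have u01 : 0 <= iter p dbl x / 2 ^+ p < (2 ^+ p)^-1.
    case/andP: t01 => t0 t1.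
    by rewrite divr_ge0 ?(ltW P0)//= ltr_pdivrMr// mulVf ?gt_eqF.
  split.
    split => //=; have := revcode_lt p x; rewrite -(ler_nat R) -natr1 natrX.
    by have := ler0n R (revcode p x); lra.
  rewrite /Phi /flow /= add0r (@floor_def _ _ (revcode p x)%:Z); last first.
    by rewrite intrD -!pmulrn; lra.
  rewrite absz_nat -pmulrn; congr pair; last by ring.
  have [h1 h2] := revcode_small _ _ u01.
  have u1 : 0 <= iter p dbl x / 2 ^+ p < 1.
    have : (2 ^+ p : R)^-1 <= 1 by rewrite invf_le1// exprn_ege1// ler1n.
    lra.
  apply: (revcode_iter_dbl_inj p) => //; first exact: iter_odometer_itv.
    by rewrite revcode_iter_odometer// h1 add0n modn_small// revcode_lt.
  rewrite iter_dbl_iter_odometer ?h1 ?add0n ?revcode_lt// h2.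
  by rewrite mulrCA divff ?mulr1// gt_eqF.
(* The phase is read off from any preimage [(u, v)]: the code of [u] is [0], so the code of its
   image is the floor of [v], and the height is the fractional part of [v]. *)
case: (Phi_inv p (x, y)) => u v [[/= u01 v01]].
rewrite /Phi /flow /= add0r => -[<- <-].
have v0 : (0 <= Num.floor v)%R by rewrite floor_ge0; lra.
have u1 : 0 <= u < 1.
  have : (2 ^+ p : R)^-1 <= 1 by rewrite invf_le1// exprn_ege1// ler1n.
  lra.
have [h1 _] := revcode_small _ _ u01.
rewrite revcode_iter_odometer// h1 add0n modn_small.
  by rewrite natr_absz ger0_norm//; ring.
rewrite -(ltr_nat R) natr_absz ger0_norm// natrX.
by have := floor_itv v; lra.
Qed.

Lemma flow_Msq s z : 0 <= s -> @Msq R z -> @Msq R (flow s z).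
Proof.
move=> s0 [x01 y01]; split; first exact: iter_odometer_itv.
by have := floor_itv (z.2 + s); rewrite /= intrD; lra.
Qed.

Lemma flow_phase p s z : 0 <= s -> @Msq R z ->
  (Phi_inv p (flow s z)).2 = rmod (2 ^+ p) ((revcode p z.1)%:R + z.2 + s).
Proof.
move=> s0 Mz; rewrite Phi_inv_phase; last exact: flow_Msq.
have [x01 y01] := Mz; have [_ /= f01] := flow_Msq s z s0 Mz.
rewrite revcode_iter_odometer//; set k := Num.floor _ in f01 *.
have k0 : (0 <= k)%R by rewrite floor_ge0; lra.
set N := (revcode p z.1 + `|k|)%N.
have P0 : 0 < (2 ^+ p : R) by rewrite exprn_gt0.
(* Euclidean division of the advanced code [N] by [2 ^ p]: the remainder is the new code, the
   quotient counts completed periods. *)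
have hN : (revcode p z.1)%:R + k%:~R = (2 ^+ p * (N %/ 2 ^ p)%:R + (N %% 2 ^ p)%:R) :> R.
  by rewrite -natrX -natrM -natrD mulnC -divn_eq natrD natr_absz ger0_norm.
have -> : (revcode p z.1)%:R + z.2 + s = 2 ^+ p * ((N %/ 2 ^ p)%N%:Z)%:~R
    + ((N %% 2 ^ p)%:R + (z.2 + s - k%:~R)).
  by rewrite -pmulrn; lra.
rewrite rmodE//.
have : (N %% 2 ^ p < 2 ^ p)%N by rewrite ltn_mod expn_gt0.
by rewrite -(ler_nat R) -natr1 natrX; have := ler0n R (N %% 2 ^ p); lra.
Qed.

End odometer_coding.

(** * Real series dominated by a convergent series, and their tails *)

Section dominated_series.
Context {R : realType}.
Implicit Types u a : nat -> R.

Lemma cvg_series_dominated u a : (forall n, `|u n| <= a n) ->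
  cvgn (fun N => \sum_(m < N) a m) -> cvgn (fun N => \sum_(m < N) u m).
Proof.
move=> ua.
have E (v : nat -> R) : (fun N => \sum_(m < N) v m) = series v.
  by apply/funext => N; rewrite /series /= big_mkord.
rewrite !E => ca; apply: normed_cvg; apply: series_le_cvg ca => //= n.
exact: le_trans (ua n).
Qed.

Lemma cvg_series_tail a n : cvgn (fun N => \sum_(m < N) a m) ->
  (fun N => \sum_(n <= m < N) a m) @ \oo -->
  limn (fun N => \sum_(m < N) a m) - \sum_(m < n) a m.
Proof.
move=> ca.
apply: (@cvg_trans _ ((fun N => \sum_(m < N) a m - \sum_(m < n) a m) @ \oo)).
  apply: near_eq_cvg; near=> N.
  have nN : (n <= N)%N by near: N; exact: nbhs_infty_ge.
  rewrite -!(big_mkord xpredT) (big_cat_nat (leq0n n) nN)/=.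
  by rewrite addrAC subrr add0r.
by apply: cvgB => //; exact: cvg_cst.
Unshelve. all: by end_near. Qed.

Lemma series_tail_le u a n : (forall n, `|u n| <= a n) ->
  cvgn (fun N => \sum_(m < N) a m) ->
  `|limn (fun N => \sum_(m < N) u m) - \sum_(m < n) u m| <=
  limn (fun N => \sum_(n <= m < N) a m).
Proof.
move=> ua ca; have cu := cvg_series_dominated _ _ ua ca.
have tu := cvg_series_tail u n cu; have ta := cvg_series_tail a n ca.
rewrite -(cvg_lim _ tu)// -lim_norm; last by apply/cvg_ex; eexists; exact: tu.
apply: ler_lim.
- by apply: is_cvg_norm; apply/cvg_ex; eexists; exact: tu.
- by apply/cvg_ex; eexists; exact: ta.
- near=> N; rewrite (le_trans (ler_norm_sum _ _ _))//.
  by apply: ler_sum => m _; exact: ua.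
Unshelve. all: by end_near. Qed.

End dominated_series.

(** * Termwise integration on a set of finite measure *)

Section integral_of_series.
Context {d} {T : measurableType d} {R : realType}.
Variable mu : {measure set T -> \bar R}.
Implicit Types (D : set T) (h : nat -> T -> R) (a : nat -> R).

Lemma integrable_le_cst D (f : T -> R) (M : R) : measurable D ->
  (mu D < +oo)%E -> measurable_fun D f -> (forall x, D x -> `|f x| <= M) ->
  mu.-integrable D (EFin \o f).
Proof.
move=> mD D_fin mf fM; apply: measurable_bounded_integrable => //.
exists M; split; first exact: num_real.
by move=> y My x Dx; exact: le_trans (fM _ Dx) (ltW My).
Qed.

Lemma le_normr_Rintegral_cst D (f : T -> R) (M : R) : measurable D ->
  (mu D < +oo)%E -> measurable_fun D f -> (forall x, D x -> `|f x| <= M) ->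
  `|\int[mu]_(x in D) f x| <= M * fine (mu D).
Proof.
move=> mD D_fin mf fM; have fi := integrable_le_cst D f M mD D_fin mf fM.
rewrite (le_trans (le_normr_Rintegral mD fi))// -Rintegral_cst//.
apply: le_Rintegral => //; first exact: integrable_norm.
by apply: (integrable_le_cst D (cst M) `|M|).
Qed.

Lemma Rintegral_sum D h n : measurable D ->
  (forall m, mu.-integrable D (EFin \o h m)) ->
  \int[mu]_(x in D) (\sum_(m < n) h m x) = \sum_(m < n) \int[mu]_(x in D) h m x.
Proof.
move=> mD hi; elim: n => [|n IH].
  rewrite big_ord0; under eq_Rintegral do rewrite big_ord0.
  by rewrite Rintegral_cst// mul0r.
under eq_Rintegral do rewrite big_ord_recr/=.
rewrite big_ord_recr/= RintegralD// ?IH//.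
have -> : EFin \o (fun x => \sum_(i < n) h i x) =
          (fun x => \sum_(i < n) (EFin \o h i) x)%E.
  by apply/funext => x /=; rewrite sumEFin.
exact: integrable_sum.
Qed.

(** Weierstrass test: the tail of [a] bounds the error of the partial sums uniformly on [D], hence
    also after integration. It serves for the time window of a Birkhoff integral and for the unit
    square. *)
Lemma integral_series D h a : measurable D -> (mu D < +oo)%E ->
  (forall n, measurable_fun D (h n)) ->
  (forall n x, D x -> `|h n x| <= a n) ->
  cvgn (fun N => \sum_(m < N) a m) ->
  mu.-integrable D (EFin \o fun x => limn (fun N => \sum_(m < N) h m x)) /\
  forall n, `|\int[mu]_(x in D) limn (fun N => \sum_(m < N) h m x)
              - \sum_(m < n) \int[mu]_(x in D) h m x|
            <= limn (fun N => \sum_(n <= m < N) a m) * fine (mu D).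
Proof.
move=> mD D_fin mh ha ca; set f := fun x => limn _.
have hi m : mu.-integrable D (EFin \o h m).
  by apply: integrable_le_cst => // x; exact: ha.
have hsum n : measurable_fun D (fun x => \sum_(m < n) h m x).
  exact: measurable_sum.
have mf : measurable_fun D f.
  apply: (@measurable_fun_cvg _ _ _ D (fun N x => \sum_(m < N) h m x)) => // x Dx.
  exact: (cvg_series_dominated (h ^~ x) a (fun m => ha m x Dx) ca).
have tail n x : D x -> `|f x - \sum_(m < n) h m x| <=
    limn (fun N => \sum_(n <= m < N) a m).
  by move=> Dx; exact: (series_tail_le (h ^~ x) a n (fun m => ha m x Dx) ca).
have fi : mu.-integrable D (EFin \o f).
  (* The tail estimate at [0] bounds the sum itself by the full sum of [a]. *)
  apply: (integrable_le_cst _ _ (limn (fun N => \sum_(0 <= m < N) a m))) => //.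
  by move=> x Dx; have := tail 0%N x Dx; rewrite big_ord0 subr0.
split=> // n; rewrite -Rintegral_sum// -RintegralB//; last first.
  have -> : EFin \o (fun x => \sum_(i < n) h i x) =
            (fun x => \sum_(i < n) (EFin \o h i) x)%E.
    by apply/funext => x /=; rewrite sumEFin.
  exact: integrable_sum.
apply: le_normr_Rintegral_cst => //; first exact: measurable_funB.
by move=> x Dx; exact: tail.
Qed.

End integral_of_series.

(** * Translation invariance, cancellation of antiperiodic functions, and measurability of the
    coding *)

Section antiperiodic_integral.
Context {R : realType}.
Notation mu := (@lebesgue_measure R).

Lemma lebesgue_measure_itv_co_lty (a b : R) : (mu `[a, b[%classic < +oo)%E.
Proof. by rewrite lebesgue_measure_itv /=; case: ifP => _; rewrite ?ltry// -EFinB ltry. Qed.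

Lemma lebesgue_measure_itv_cc (t : R) : 0 <= t -> mu `[0, t]%classic = t%:E.
Proof.
move=> t0; rewrite lebesgue_measure_itv /= lte_fin; case: ltP => t0'.
  by rewrite -EFinB subr0.
by congr EFin; lra.
Qed.

Lemma Rintegral_indic_co_le (t b l : R) : 0 <= t -> 0 <= l ->
  \int[mu]_(s in `[0, t]) \1_(`[b, b + l[) s <= l.
Proof.
move=> t0 l0; rewrite /Rintegral integral_indic//.
have h : (mu (`[b, (b + l)%R[ `&` `[0%R, t]) <= mu `[b, (b + l)%R[%classic)%E.
  by apply: le_measure; rewrite ?inE//=; exact: measurableI.
have hl : mu `[b, b + l[%classic = l%:E.
  rewrite lebesgue_measure_itv /= lte_fin; case: ifP => hb.
    by rewrite -EFinB; congr EFin; ring.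
  by congr EFin; move/negbT: hb; rewrite -leNgt; lra.
rewrite -lee_fin fineK -?hl//.
by rewrite ge0_fin_numE//; apply: (le_lt_trans h); rewrite hl ltry.
Qed.

Lemma measurable_addr (c : R) : measurable_fun setT (fun x : R => x + c).
Proof. exact: measurable_funD. Qed.

(** By uniqueness of Lebesgue measure it suffices to compare the lengths of half-open intervals. *)
Lemma lebesgue_measure_shift (c : R) (A : set R) : measurable A ->
  pushforward mu ((fun x : R => x + c) : _ -> measurableTypeR R) A = mu A.
Proof.
move=> mA; have mphi := measurable_addr c.
apply/esym/lebesgue_measure_unique => //= _ [[a b]] _ <-.
rewrite /pushforward /= (_ : _ @^-1` _ = `]a - c, b - c]%classic).
  rewrite !lebesgue_measure_itv /= !lte_fin ltrD2r; case: ifP => // _.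
  by rewrite -!EFinB; congr EFin; ring.
by apply/seteqP; split=> x /=; rewrite !in_itv /=; lra.
Qed.

(** Change of variables along the pushforward by a translation; the bound [M] supplies
    integrability. *)
Lemma integral_shift (H : R -> R) (M c a b : R) : measurable_fun setT H ->
  (forall x, `|H x| <= M) ->
  (\int[mu]_(x in `[(a + c)%R, (b + c)%R[) (H x)%:E =
   \int[mu]_(x in `[a, b[) (H (x + c)%R)%:E)%E.
Proof.
move=> mH HM; have mphi : @measurable_fun _ _ (measurableTypeR R) (measurableTypeR R) setT
  (fun x => x + c) := measurable_addr c.
have pre : `[a, b[%classic =
    ((fun x : R => x + c) : _ -> measurableTypeR R) @^-1` `[a + c, b + c[.
  by apply/seteqP; split=> x /=; rewrite !in_itv /=; lra.
transitivity (\int[pushforward mu ((fun x : R => x + c)%R : _ -> measurableTypeR R)]_(x in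
    `[(a + c)%R, (b + c)%R[) (H x)%:E)%E.
  by apply: eq_measure_integral => //= A mA AS; exact/esym/lebesgue_measure_shift.
rewrite pre; apply: (integral_pushforward mphi (f := EFin \o H)) => //=.
- exact/measurable_EFinP.
- rewrite -pre; apply: (integrable_le_cst mu _ (fun x => H (x + c)) M) => //.
  + exact: lebesgue_measure_itv_co_lty.
  + by apply: measurable_funTS; exact: (measurableT_comp mH mphi).
Qed.

Lemma integral_split_co (H : R -> R) (a b c : R) : measurable_fun setT H ->
  a <= b <= c -> (\int[mu]_(x in `[a, c[) (H x)%:E =
  \int[mu]_(x in `[a, b[) (H x)%:E + \int[mu]_(x in `[b, c[) (H x)%:E)%E.
Proof.
move=> mH abc.
rewrite (@itv_bndbnd_setU _ _ _ (BLeft b)) ?bnd_simp; [|lra|lra].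
apply: integral_setU => //.
- by apply/measurable_EFinP; exact: measurable_funTS.
- by apply/disj_setPS => x /=; rewrite !in_itv/=; lra.
Qed.

(** Each even cell of length [Q] cancels against the odd cell after it. The sign change is asked on
    even cells only, which suits the flipping of a binary digit: adding [Q] turns that digit from 0
    to 1 there. *)
Lemma integral_antiperiodic0 (H : R -> R) (M Q : R) (N : nat) : 0 <= Q ->
  measurable_fun setT H -> (forall x, `|H x| <= M) ->
  (forall j r, (j < N)%N -> j.*2%:R * Q <= r < j.*2.+1%:R * Q ->
    H (r + Q) = - H r) ->
  (\int[mu]_(x in `[0%R, (N.*2%:R * Q)%R[) (H x)%:E = 0)%E.
Proof.
move=> Q0 mH HM; elim: N => [|N IH] HQ.
  by rewrite mul0r set_itv_ge ?bnd_simp// integral_set0.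
have NQ : 0 <= N.*2%:R * Q by rewrite mulr_ge0.
have E1 : N.*2.+1%:R * Q = N.*2%:R * Q + Q by rewrite -natr1; ring.
have E2 : N.+1.*2%:R * Q = N.*2.+1%:R * Q + Q by rewrite doubleS -natr1; ring.
rewrite (integral_split_co _ _ (N.*2%:R * Q))//; last by lra.
rewrite IH; last by move=> j r jN; apply: HQ; lia.
rewrite add0e (integral_split_co _ _ (N.*2.+1%:R * Q))//; last by lra.
rewrite E2 [in X in (_ + X)%E]E1 (integral_shift _ M)// -E1.
under [X in (_ + X)%E]eq_integral => x.
  rewrite inE /= in_itv /= => xN.
  rewrite (HQ N)// EFinN.
  over.
rewrite integralN.
  rewrite subee//; apply: integrable_fin_num => //.
  apply: (integrable_le_cst mu _ H M) => //.
  - exact: lebesgue_measure_itv_co_lty.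
  - exact: measurable_funTS.
apply: integrable_add_def => //.
apply: (integrable_le_cst mu _ H M) => //.
- exact: lebesgue_measure_itv_co_lty.
- exact: measurable_funTS.
Qed.

Lemma measurable_rmod (P : R) : 0 < P -> measurable_fun setT (rmod P).
Proof.
move=> P0; rewrite /rmod; apply: measurable_funB => //.
apply: nondecreasing_measurable => // x y xy.
by rewrite ler_pM2l// ler_int; apply: le_floor; rewrite ler_pM2r ?invr_gt0.
Qed.

Lemma measurable_dbl : measurable_fun setT (@dbl R).
Proof.
apply: measurable_funB; first exact: measurable_funM.
apply: nondecreasing_measurable => // x y xy.
by rewrite ler_nat; case: (lerP 2^-1 x) => // /le_trans/(_ xy) ->.
Qed.

Lemma measurable_revcode p : measurable_fun setT (fun x : R => (revcode p x)%:R : R).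
Proof.
elim: p => [|p IH] /=; first exact: measurable_cst.
under eq_fun do rewrite natrD -muln2 natrM.
apply: measurable_funD.
  apply: nondecreasing_measurable => // x y xy.
  by rewrite ler_nat; case: (lerP 2^-1 x) => // /le_trans/(_ xy) ->.
apply: measurable_funM => //; apply: (measurableT_comp IH); exact: measurable_dbl.
Qed.

End antiperiodic_integral.

(** * The unit square as a product of intervals *)

Section unit_square.
Context {R : realType}.
Notation mu := (@lebesgue_measure R).
Notation mu2 := (mu \x mu)%E.

Lemma MsqE : @Msq R = `[0, 1[%classic `*` `[0, 1[%classic.
Proof. by apply/seteqP; split=> z /=; rewrite !in_itv. Qed.

Lemma mem_Msq (x y : R) : ((x, y) \in @Msq R) =
  (x \in `[0, 1[%classic) && (y \in `[0, 1[%classic).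
Proof.
rewrite MsqE; apply/idP/andP => [/set_mem[]|[/set_mem hx /set_mem hy]].
  by move=> hx hy; split; exact/mem_set.
exact/mem_set.
Qed.

Lemma measurable_Msq :
  measurable (@Msq R : set (measurableTypeR R * measurableTypeR R)).
Proof. by rewrite MsqE; exact: measurableX. Qed.

Lemma mu2_Msq : mu2 (@Msq R) = 1%E.
Proof.
rewrite MsqE product_measure1E//= !lebesgue_measure_itv/= lte_fin ltr01.
by rewrite oppr0 adde0 mule1.
Qed.

End unit_square.

(** * The summands of [f] as periodic step functions of the phase *)

Section profile.
Context {R : realType}.
Variables (p : nat -> nat) (d a : nat -> R).
Hypothesis hd : forall n, 0 < d n < 2^-1.
Hypothesis ha : forall n, 0 < a n.
Notation mu := (@lebesgue_measure R).
Notation mu2 := (mu \x mu)%E.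

(** [fpiece] depends on the second coordinate alone; the first is filled with [0]. *)
Definition profile n (r : R) : R := fpiece p d a n (0, r).
(** The exponent is an integer, so that [p n = 0] gives [1/2]. *)
Definition half_period n : R := 2 ^ ((p n)%:Z - 1).

Lemma half_period_gt0 n : 0 < half_period n.
Proof. exact: exprz_gt0. Qed.

Lemma half_periodE n : 2 ^+ p n = 2 * half_period n.
Proof. by rewrite /half_period expfzDr// exprN1 -exprnP mulrCA divff ?mulr1. Qed.

Lemma Lseq_itv n : 0 < Lseq p d n < half_period n / 2.
Proof.
have := half_period_gt0 n; have := hd n; rewrite /Lseq -/(half_period n) => /andP[d0 d1] q0.
by rewrite mulr_gt0//= mulrC ltr_pM2l.
Qed.

Lemma profile_le n r : `|profile n r| <= a n.
Proof.
have := ha n; rewrite /profile /fpiece; case: ifP => _; first by move=> a0; rewrite gtr0_norm.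
by case: ifP => _ a0; rewrite ?normr0 ?normrN ?gtr0_norm// ltW.
Qed.

Lemma measurable_profile n : measurable_fun setT (profile n).
Proof.
rewrite /profile /fpiece /=; apply: measurable_fun_ifT => //.
  by apply: measurable_and; [apply: measurable_fun_ler|apply: measurable_fun_ltr].
apply: measurable_fun_ifT => //.
by apply: measurable_and; [apply: measurable_fun_ler|apply: measurable_fun_ltr].
Qed.

Lemma profile_shift n r : 0 <= r < half_period n -> profile n (r + half_period n) = - profile n r.
Proof.
move=> r0; have := Lseq_itv n; rewrite /profile /fpiece /= -/(half_period n).
set L := Lseq p d n => LQ; have [rL|rL] := ltP r L.
  rewrite (_ : r + half_period n < L = false) ?andbF; last by apply/negbTE; rewrite -leNgt; lra.
  rewrite (_ : (half_period n <= r + half_period n) && (r + half_period n < half_period n + L)); last by lra.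
  by rewrite (_ : 0 <= r)//; lra.
rewrite (_ : r + half_period n < L = false) ?andbF; last by apply/negbTE; rewrite -leNgt; lra.
rewrite (_ : r + half_period n < half_period n + L = false) ?andbF; last by apply/negbTE; rewrite -leNgt; lra.
rewrite (_ : half_period n <= r = false) ?oppr0//.
by apply/negbTE; rewrite -ltNge; lra.
Qed.

Definition periodic_profile n (r : R) : R := profile n (rmod (2 ^+ p n) r).

Lemma periodic_profile_antiperiodic n r : periodic_profile n (r + half_period n) = - periodic_profile n r.
Proof.
have P0 : 0 < (2 ^+ p n : R) by rewrite exprn_gt0.
have := rmod_itv _ r P0; rewrite /periodic_profile; set c := rmod _ r => c01.
set k := Num.floor (r / 2 ^+ p n).
have rE : r = 2 ^+ p n * k%:~R + c by rewrite /c /rmod -/k; ring.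
have q0 := half_period_gt0 n; rewrite half_periodE in c01.
have [cQ|cQ] := ltP c (half_period n).
  rewrite (_ : r + half_period n = 2 ^+ p n * k%:~R + (c + half_period n)); last by rewrite {1}rE; ring.
  by rewrite rmodE//; [rewrite profile_shift//; lra|rewrite half_periodE; lra].
rewrite (_ : r + half_period n = 2 ^+ p n * (k + 1)%:~R + (c - half_period n)); last first.
  by rewrite {1}rE intrD half_periodE; ring.
rewrite rmodE//; last by rewrite half_periodE; lra.
by rewrite -[in RHS](subrK (half_period n) c) profile_shift ?opprK//; lra.
Qed.

Lemma measurable_periodic_profile n v : measurable_fun setT (fun s : R => periodic_profile n (v + s)).
Proof.
apply: (measurableT_comp (measurable_profile n)).
apply: (measurableT_comp (measurable_rmod _ _)); first exact: exprn_gt0.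
exact: measurable_funD.
Qed.

(* A window shorter than half a period meets the support of [|periodic_profile n|], which
   has period [half_period n], in a subset of two intervals of length [Lseq p d n]. *)
Lemma periodic_profile_window n v s : let v0 := rmod (half_period n) v in
  0 <= s <= half_period n / 2 ->
  `|periodic_profile n (v + s)| <= a n * (\1_(`[0, Lseq p d n[) s +
     \1_(`[half_period n - v0, half_period n - v0 + Lseq p d n[) s).
Proof.
move=> v0 s01; have q0 := half_period_gt0 n; have L0 := Lseq_itv n; have a0 := ha n.
have v01 : 0 <= v0 < half_period n by exact: rmod_itv.
have P0 : 0 < (2 ^+ p n : R) by rewrite exprn_gt0.
have := rmod_itv _ (v + s) P0; rewrite /periodic_profile; set c := rmod _ (v + s) => c01.
set L := Lseq p d n in L0 *.
have [h0|h0] := eqVneq (profile n c) 0.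
  by rewrite h0 normr0 mulr_ge0 ?addr_ge0// ltW.
apply: (le_trans (profile_le n c)); rewrite -[leLHS]mulr1 ler_pM2l//.
(* Both blocks of the support start at a multiple of the half period, so modulo [half_period n] the
   phase falls in [[0, L)]; [i] is the index of the half period reached by [v0 + s]. *)
have [c' [i [c'01 iE]]] : exists c' (i : int), 0 <= c' < L /\ v0 + s = half_period n * i%:~R + c'.
  pose k := Num.floor ((v + s) / 2 ^+ p n); pose j := Num.floor (v / half_period n).
  have cE : v + s = 2 * half_period n * k%:~R + c by rewrite -half_periodE /c /rmod -/k; ring.
  have vE : v = half_period n * j%:~R + v0 by rewrite /v0 /rmod -/j; ring.
  move: h0; rewrite /profile /fpiece /= -/(half_period n) -/L.
  case: ifP => [cL _|_].
    exists c, (2 * k - j); split => //; rewrite intrD rmorphN rmorphM /=.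
    by rewrite (_ : 2%:~R = 2)//; lra.
  case: ifP => [cL _|_]; last by rewrite eqxx.
  exists (c - half_period n), (2 * k - j + 1); split; first by lra.
  rewrite !intrD rmorphN rmorphM /=.
  by rewrite (_ : 2%:~R = 2)//; lra.
(* Since [v0 + s] is nonnegative and below [3/2] of [half_period n], only the indices [0] and [1]
   remain, one for each interval. *)
have i0 : (-1 < i)%R by rewrite -(ltr_int R) -(ltr_pM2l q0) rmorphN /=; lra.
have i2 : (i < 2)%R by rewrite -(ltr_int R) -(ltr_pM2l q0) (_ : 2%:~R = 2)//; lra.
have [i0'|i1] : i = 0 \/ i = 1 by lia.
  have /mem_set sA : `[0, L[%classic s.
    by rewrite /= in_itv/=; move: iE; rewrite i0' mulr0; lra.
  by rewrite !indicE sA lerDl.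
have /mem_set sB : `[half_period n - v0, half_period n - v0 + L[%classic s.
  by rewrite /= in_itv/=; move: iE; rewrite i1 mulr1; lra.
by rewrite !indicE sB lerDr.
Qed.

Lemma integral_periodic_profile_le n v :
  `|\int[mu]_(s in `[0, half_period n / 2]) periodic_profile n (v + s)|
  <= 2 * (a n * Lseq p d n).
Proof.
have q0 := half_period_gt0 n; have /andP[L0 _] := Lseq_itv n; have a0 := ha n.
set t := half_period n / 2; have t0 : 0 <= t by rewrite divr_ge0// ltW.
have t_fin : (mu `[0%R, t]%classic < +oo)%E by rewrite lebesgue_measure_itv_cc// ltry.
have mh := measurable_periodic_profile n v.
have hi : mu.-integrable `[0, t] (EFin \o (fun s => periodic_profile n (v + s))).
  apply: (integrable_le_cst mu _ _ (a n)) => //; last by move=> x _; exact: profile_le.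
  exact: measurable_funTS.
apply: (le_trans (le_normr_Rintegral _ hi)) => //.
set b := half_period n - rmod (half_period n) v.
have ii (A : set R) : measurable A -> mu.-integrable `[0, t] (EFin \o \1_A).
  move=> mA; apply: (integrable_le_cst mu _ _ 1) => //.
  by move=> x _; rewrite indicE ger0_norm// lern1 leq_b1.
(* The endpoint is written [0 + Lseq p d n] so that [Rintegral_indic_co_le] applies to both
   indicators. *)
pose g s : R := a n * (\1_(`[0, 0 + Lseq p d n[) s + \1_(`[b, b + Lseq p d n[) s).
have isum : mu.-integrable `[0, t] (EFin \o (fun s => \1_(`[0, 0 + Lseq p d n[) s +
    \1_(`[b, b + Lseq p d n[) s : R)).
  have := integrableD _ (ii `[0, 0 + Lseq p d n[%classic _) (ii `[b, b + Lseq p d n[%classic _).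
  by apply.
apply: (@le_trans _ _ (\int[mu]_(s in `[0, t]) g s)).
  apply: le_Rintegral => //.
  - exact: integrable_norm hi.
  - by have := integrableZl _ (a n) isum; apply.
  - move=> s /=; rewrite in_itv /= /g add0r => s01.
    exact: periodic_profile_window.
rewrite /g RintegralZl// RintegralD//; [|exact: ii|exact: ii].
rewrite mulrCA ler_pM2l// mulr_natl mulr2n lerD//; apply: Rintegral_indic_co_le => //; exact: ltW.
Qed.

Lemma integral_periodic_profile0 n N v :
  \int[mu]_(s in `[0, N.*2%:R * half_period n]) periodic_profile n (v + s) = 0.
Proof.
have mh := measurable_periodic_profile n v.
have q0 := half_period_gt0 n.
rewrite -Rintegral_itv_bndo_bndc; last first.
  apply: (integrable_le_cst mu _ _ (a n)) => //.
  - exact: lebesgue_measure_itv_co_lty.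
  - exact: measurable_funTS.
  - by move=> x _; exact: profile_le.
rewrite /Rintegral (integral_antiperiodic0 _ (a n))//; first exact: ltW.
- by move=> x; exact: profile_le.
- by move=> j r _ _; rewrite addrA periodic_profile_antiperiodic.
Qed.

Lemma fsum_Msq z : @Msq R z ->
  fsum p d a z = limn (fun N => \sum_(n < N) profile n ((revcode (p n) z.1)%:R + z.2)).
Proof.
move=> Mz; rewrite /fsum; congr (limn _); apply/funext => N.
by apply: eq_bigr => i _; rewrite -Phi_inv_phase.
Qed.

Lemma fsum_flow z s : 0 <= s -> @Msq R z -> fsum p d a (flow s z) =
  limn (fun N => \sum_(n < N)
    periodic_profile n ((revcode (p n) z.1)%:R + z.2 + s)).
Proof.
move=> s0 Mz; rewrite /fsum; congr (limn _); apply/funext => N.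
by apply: eq_bigr => i _; rewrite /periodic_profile -flow_phase.
Qed.

Hypothesis hp : forall n, (p n + 2 <= p n.+1)%N.

Lemma exponent_gap m n : (m < n)%N -> (p m + 2 <= p n)%N.
Proof.
elim: n => // n IH; rewrite ltnS leq_eqVlt => /predU1P[->|/IH h]; first exact: hp.
by have := hp n; lia.
Qed.

Hypothesis hsum : cvgn (fun N => \sum_(m < N) a m).

Lemma birkhoff_fsum_le n z : @Msq R z ->
  `|birkhoff (fsum p d a) (2 ^ ((p n)%:Z - 2)) z| <=
  4 * (a n * d n) + limn (fun N => \sum_(n.+1 <= m < N) a m).
Proof.
move=> Mz; have q0 := half_period_gt0 n.
have tE : 2 ^ ((p n)%:Z - 2) = half_period n / 2 :> R.
  by rewrite /half_period (_ : (p n)%:Z - 2 = (p n)%:Z - 1 - 1) ?[LHS]expfzDr//; lia.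
rewrite tE /birkhoff; set t := half_period n / 2.
have t0 : 0 < t by rewrite divr_gt0.
pose v m := (revcode (p m) z.1)%:R + z.2.
rewrite (@eq_Rintegral _ _ _ mu _ (fun s => limn (fun N => \sum_(m < N)
    periodic_profile m (v m + s)))); last first.
  by move=> s; rewrite inE /= in_itv /= => /andP[s0 _]; exact: fsum_flow.
have mt : mu `[0%R, t]%classic = t%:E by rewrite lebesgue_measure_itv_cc// ltW.
have t_fin : (mu `[0%R, t]%classic < +oo)%E by rewrite mt ltry.
have [] := @integral_series _ _ _ mu `[0, t]%classic
  (fun m s => periodic_profile m (v m + s)) a _ _ _ _ hsum => //.
- by move=> m; apply: measurable_funTS; exact: measurable_periodic_profile.
- by move=> m s _; exact: profile_le.
(* Cutting at [n.+1] keeps the summand [n] among the explicit terms and leaves the strict tail as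
   error. *)
move=> _ /(_ n.+1); rewrite (_ : fine _ = t); last exact: (congr1 fine mt).
rewrite big_ord_recr /= big1 ?add0r; last first.
  move=> m _; have mn := exponent_gap _ _ (ltn_ord m).
  (* The gap [p m + 2 <= p n] makes [t] a whole number of periods [2 ^ p m], each of two half
     periods. *)
  have -> : t = (2 ^ (p n - 2 - p m))%N.*2%:R * half_period m.
    rewrite -muln2 natrM -mulrA -half_periodE natrX -exprD /t -tE.
    by rewrite exprnP; congr (_ ^ _); lia.
  exact: integral_periodic_profile0.
have := integral_periodic_profile_le n (v n); rewrite -/t.
set I := Rintegral _ _ _; set J := Rintegral _ _ _ => hI hJ.
rewrite normrM gtr0_norm ?invr_gt0// ler_pdivrMl//.
(* The constant 4 arises because [Lseq p d n] is [d n] times the half period, that is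
   [2 * t * d n]. *)
have LE : 2 * (a n * Lseq p d n) = t * (4 * (a n * d n)).
  by rewrite /Lseq -/(half_period n) /t; field.
rewrite mulrDr -LE [t * limn _]mulrC.
by rewrite -[J](subrK I) (le_trans (ler_normD _ _))// addrC lerD.
Qed.

(** * Vanishing of the mean over the unit square *)

Lemma measurable_profile_phase n : measurable_fun
  (setT : set (measurableTypeR R * measurableTypeR R))
  (fun z : R * R => profile n ((revcode (p n) z.1)%:R + z.2)).
Proof.
apply: (measurableT_comp (measurable_profile n)).
apply: measurable_funD.
  exact: (measurableT_comp (measurable_revcode (p n)) measurable_fst).
exact: measurable_snd.
Qed.

(** The last digit read has weight [2 ^ (p n - 1)] in the code, which is the half period. Adding
    [2 ^ (- p n)] to [x] where this digit is 0 therefore reverses the sign of the summand. *)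
Lemma integral_profile_section n y : (0 < p n)%N -> 0 <= y < 1 ->
  (\int[mu]_(x in `[0%R, 1%R[) (profile n ((revcode (p n) x)%:R + y))%:E = 0)%E.
Proof.
move=> pn0 y01; set q := (p n).-1; have pE : p n = q.+1 by rewrite prednK.
have N0 : 0 < (2 ^+ q.+1 : R) by rewrite exprn_gt0.
have hE : half_period n = 2 ^+ q.
  by rewrite /half_period exprnP; congr (_ ^ _); rewrite pE; lia.
have {1}-> : 1 = (2 ^ q)%N.*2%:R * (2 ^+ q.+1)^-1 :> R.
  by rewrite -mul2n -expnS natrX divff// gt_eqF.
apply: (integral_antiperiodic0 _ (a n)).
- by rewrite invr_ge0 ltW.
- apply: (measurableT_comp (measurable_profile n)).
  by apply: measurable_funD => //; exact: measurable_revcode.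
- by move=> x; exact: profile_le.
move=> j r jN; rewrite ler_pdivrMr// ltr_pdivlMr// => rj.
have jN' : (j.*2%:R + 2 <= 2 ^+ q.+1 :> R).
  by rewrite -natrX -natrD ler_nat expnS; lia.
have r01 : 0 <= r < 1.
  have : 0 <= r * 2 ^+ q.+1 < 1 * 2 ^+ q.+1.
    have := ler0n R j.*2; move: rj; rewrite -[j.*2.+1%:R]natr1; lra.
  by rewrite pmulr_lge0// ltr_pM2r.
(* On the even cell with index [2 * j] the integer part of [2 ^+ q * r] is [j] and its fractional
   part is below [1/2], so the digit to be flipped is 0. *)
have rq : iter q dbl r < 2^-1.
  have [k kE] := iter_dbl_frac q r; have := iter_dbl_itv q _ r01.
  set c := iter q dbl r in kE * => c01.
  move: rj; rewrite exprS mulrCA [r * _]mulrC kE -[j.*2.+1%:R]natr1 -muln2 natrM => rj.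
  suff -> : c = c + k%:~R - j%:R by lra.
  have -> : k = j%:Z; last by rewrite -pmulrn; ring.
  have h1 : (j%:Z < k + 1)%R by rewrite -(ltr_int R) intrD -pmulrn; lra.
  have h2 : (k < j%:Z + 1)%R by rewrite -(ltr_int R) intrD -pmulrn; lra.
  by lia.
have [h1 h2] := revcode_toggle q r r01 rq.
rewrite pE h2 natrD natrX -hE addrAC profile_shift//.
(* The code after the flip is still below [2 ^ q.+1], so the code before it is below [2 ^ q] and the
   phase lies in the first half period. *)
have := revcode_lt q.+1 (r + (2 ^+ q.+1)^-1); rewrite h2 expnS mul2n -addnn ltn_add2r.
by rewrite hE -(ler_nat R) -natr1 natrX; have := ler0n R (revcode q.+1 r); lra.
Qed.

(** With [p n = 0] no digit is read and the phase is [y] itself; the cancellation takes place in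
    [y], between the two halves of [[0, 1)]. *)
Lemma integral_profile_fiber n (x : R) : p n = 0%N ->
  (\int[mu]_(y in `[0%R, 1%R[) (profile n ((revcode (p n) x)%:R + y))%:E = 0)%E.
Proof.
move=> pn0; have hE : half_period n = 2^-1.
  by rewrite /half_period pn0 sub0r exprN1.
have {1}-> : 1 = 1%N.*2%:R * 2^-1 :> R by rewrite divff.
apply: (integral_antiperiodic0 _ (a n)) => //.
- apply: (measurableT_comp (measurable_profile n)); exact: measurable_funD.
- by move=> y; exact: profile_le.
move=> j r; rewrite ltnS leqn0 => /eqP -> /=; rewrite mul0r mul1r => r01.
by rewrite pn0 /= !add0r -hE profile_shift// hE.
Qed.

Lemma integral_profile_Msq n :
  (\int[mu2]_(z in @Msq R) (profile n ((revcode (p n) z.1)%:R + z.2))%:E = 0)%E.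
Proof.
set F := fun z : R * R => profile n ((revcode (p n) z.1)%:R + z.2).
have mM := measurable_Msq.
have M_fin : (mu2 (@Msq R) < +oo)%E by rewrite mu2_Msq ltry.
have iF : mu2.-integrable (@Msq R) (EFin \o F).
  apply: (integrable_le_cst mu2 _ F (a n)) => //.
  - by apply: measurable_funTS; exact: measurable_profile_phase.
  - by move=> z _; exact: profile_le.
rewrite integral_mkcond.
have iF' := iF; rewrite integrable_mkcond// in iF'.
(* Fubini is used with the cancelling variable innermost: [y] if [p n = 0], and [x] otherwise. *)
have [pn0|pn0] := posnP (p n).
  rewrite -(integral12_prod_meas1 iF') integral0_eq// => x _.
  rewrite /fubini_F.
  have [x01|x01] := boolP (x \in `[0, 1[%classic).
    rewrite -(integral_profile_fiber n x pn0) [RHS]integral_mkcond.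
    apply: eq_integral => y _; rewrite /= !patchE.
    by rewrite mem_Msq x01.
  by rewrite integral0_eq// => y _; rewrite patchE mem_Msq (negbTE x01).
rewrite -(integral21_prod_meas1 iF') integral0_eq// => y _.
rewrite /fubini_G.
have [y01|y01] := boolP (y \in `[0, 1[%classic).
  have y01' : 0 <= y < 1 by move: y01; rewrite inE /= in_itv.
  rewrite -(integral_profile_section n y pn0 y01') [RHS]integral_mkcond.
  apply: eq_integral => x _; rewrite /= !patchE.
  by rewrite mem_Msq y01 andbT.
by rewrite integral0_eq// => x _; rewrite patchE mem_Msq (negbTE y01) andbF.
Qed.

Lemma integrable_fsum : mu2.-integrable (@Msq R) (EFin \o fsum p d a) /\
  (\int[mu2]_(z in @Msq R) (fsum p d a z)%:E = 0)%E.
Proof.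
have mM := measurable_Msq.
have M_fin : (mu2 (@Msq R) < +oo)%E by rewrite mu2_Msq ltry.
have [] := @integral_series _ _ _ mu2 (@Msq R)
  (fun n z => profile n ((revcode (p n) z.1)%:R + z.2)) a _ _ _ _ hsum => //.
- by move=> n; apply: measurable_funTS; exact: measurable_profile_phase.
- by move=> n z _; exact: profile_le.
set g := fun z : R * R => limn _; move=> ig tail.
have fg : {in @Msq R, fsum p d a =1 g} by move=> z /set_mem; exact: fsum_Msq.
have if_ : mu2.-integrable (@Msq R) (EFin \o fsum p d a).
  by apply: eq_integrable ig => // z zM; rewrite /= fg.
split=> //.
rewrite -[LHS]fineK; last exact: integrable_fin_num.
(* Every partial sum has mean 0, so the mean of [f] is bounded by each tail of [a], hence by any
   [e > 0]. *)
congr EFin; apply/eqP; rewrite -normr_le0; apply/ler_addgt0Pr => e e0.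
have /cvgrPdist_lt/(_ e e0)[n _ /(_ n (leqnn n)) /= hn] := hsum.
have -> : fine (\int[mu2]_(z in @Msq R) (fsum p d a z)%:E)%E =
    Rintegral mu2 (@Msq R) g by exact: eq_Rintegral.
rewrite add0r; have := tail n; rewrite (_ : fine _ = 1); last exact: (congr1 fine mu2_Msq).
rewrite mulr1 big1 ?subr0; last first.
  by move=> i _; rewrite /Rintegral integral_profile_Msq.
rewrite (cvg_lim _ (cvg_series_tail _ n hsum))// => h.
exact: le_trans h (le_trans (ler_norm _) (ltW hn)).
Qed.

End profile.

Theorem theorem2 (R : realType) (p : nat -> nat) (d a : nat -> R)
  (hp : forall n, (p n + 2 <= p n.+1)%N)
  (hd : forall n, 0 < d n < 2^-1)
  (ha : forall n, 0 < a n)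
  (hsum : cvgn (fun N => \sum_(m < N) a m))
  (htail : (fun n => limn (fun N => \sum_(n.+1 <= m < N) a m))
             =o_\oo (fun n => a n * d n))
  (hL : forall n m, (n < m)%N -> 2 ^ ((p n)%:Z - 2) < d m * 2 ^ ((p m)%:Z - 1)) :
  let f := fsum p d a in
  let t := fun n => (2 : R) ^ ((p n)%:Z - 2) in
  let mu := (@lebesgue_measure R \x @lebesgue_measure R)%E in
  [/\ mu.-integrable (@Msq R) (EFin \o f),
      (\int[mu]_(z in @Msq R) (f z)%:E = 0)%E &
      exists C : R, \forall n \near \oo,
        forall z, @Msq R z -> `|birkhoff f (t n) z| <= C * (a n * d n)].
Proof.
move=> f t mu; have [fi f0] := integrable_fsum p d a hd ha hsum.
(* Here 5 is 4 from the summand [n] plus 1 from the tail, the little-o hypothesis being used with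
   constant 1. *)
split=> //; exists 5.
have ad0 m : 0 < a m * d m by rewrite mulr_gt0//; case/andP: (hd m).
move/eqoP: htail => /(_ 1 ltr01); apply: filterS => n; rewrite mul1r => hn z Mz.
apply: (le_trans (birkhoff_fsum_le p d a hd ha hp hsum n z Mz)).
rewrite [`|a n * d n|]gtr0_norm// in hn.
have := le_trans (ler_norm _) hn; set T := limn _; lra.
Qed.
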